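(* Let $W_\Gamma$ be a Coxeter group. If $W_\Gamma$ is in the class $\mathcal{W}$, i.e. $\mathrm{Aut}(W_\Gamma)$ has a finite index subgroup that admits a surjective homomorphism onto some infinite Coxeter group, then $\mathrm{Aut}(W_\Gamma)$ is virtually indicable and therefore does not have Kazhdan's property (T).
   Context: A Coxeter graph is a finite simplicial graph $\Gamma$ with vertex set $V(\Gamma)$, edge set $E(\Gamma)$ (a set of two-element subsets of $V(\Gamma)$) and an edge-labeling $\varphi\colon E(\Gamma)\to\{2,3,4,\ldots\}$. The associated Coxeter group is $$W_\Gamma=\langle V(\Gamma)\mid v^2 \text{ for all } v\in V(\Gamma),\ (vw)^{\varphi(\{v,w\})}\text{ for all }\{v,w\}\in E(\Gamma)\rangle$$ (there is no relation between $v$ and $w$ when they are not adjacent). $\mathcal{W}$ denotes the class of (infinite) Coxeter groups $W_\Gamma$ such that $\mathrm{Aut}(W_\Gamma)$ virtually maps onto some infinite Coxeter group, i.e. some finite index subgroup of $\mathrm{Aut}(W_\Gamma)$ surjects onto an infinite Coxeter group. A group $G$ is virtually indicable if it has a finite index subgroup $H\subseteq G$ that surjects onto $\mathbb{Z}$. A countable group $G$ has Kazhdan's property (T) if every action of $G$ on a real Hilbert space by (affine) isometries has a global fixed point. *)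

(* Defs.v *)
From HB Require Import structures.
From mathcomp Require Import all_boot all_order all_algebra.
From mathcomp Require Import boolp classical_sets functions cardinality reals.
From mathcomp Require Import topology normedtype.

Set Implicit Arguments.
Unset Strict Implicit.
Unset Printing Implicit Defensive.

Import GRing.Theory Num.Theory.
Import numFieldNormedType.Exports.

Local Open Scope classical_set_scope.
Local Open Scope group_scope.
Local Open Scope quotient_scope.

(* Words in the letters s and s^-1: the letter (s, false) stands for s and
   (s, true) for its formal inverse. *)
Definition word (S : choiceType) := seq (S * bool).

Definition inv_word (S : choiceType) (u : word S) : word S :=
  rev [seq (l.1, ~~ l.2) | l <- u].

Section Presentation.
Context (S : choiceType) (rel : set (word S)).

Inductive pres_rel : word S -> word S -> Prop :=
| pres_refl u : pres_rel u u
| pres_sym u v : pres_rel u v -> pres_rel v u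
| pres_trans v u w : pres_rel u v -> pres_rel v w -> pres_rel u w
| pres_cancel u v s b : pres_rel (u ++ [:: (s, b); (s, ~~ b)] ++ v) (u ++ v)
| pres_relator u v r : rel r -> pres_rel (u ++ r ++ v) (u ++ v).

Definition pres_relb (u v : word S) : bool := `[< pres_rel u v >].

Lemma pres_relb_equiv : equiv_class_of pres_relb.
Proof.
split=> [u|u v|v u w].
- exact/asboolP/pres_refl.
- by apply/asboolP/asboolP; exact: pres_sym.
- by move=> /asboolP uv /asboolP vw; exact/asboolP/(pres_trans uv).
Qed.

Canonical pres_equiv := EquivRelPack pres_relb_equiv.

(* The group < S | rel >. *)
Definition pres_group := {eq_quot pres_equiv}.
HB.instance Definition _ := Choice.on pres_group.
HB.instance Definition _ := EqQuotient.on pres_group.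

Definition pres_pi (u : word S) : pres_group := \pi_pres_group u.

Lemma pres_piP u v : pres_pi u = pres_pi v <-> pres_rel u v.
Proof.
split=> [/eqP|uv]; first by rewrite /pres_pi eqmodE => /asboolP.
by apply/eqP; rewrite /pres_pi eqmodE; exact/asboolP.
Qed.

Lemma pres_piK (x : pres_group) : pres_pi (repr x) = x.
Proof. exact: reprK. Qed.

Lemma pres_reprK (u : word S) : pres_rel (repr (pres_pi u)) u.
Proof. by apply/pres_piP; rewrite pres_piK. Qed.

Lemma pres_catl w u v : pres_rel u v -> pres_rel (w ++ u) (w ++ v).
Proof.
elim=> {u v} [u|u v _|v u x _ uv _|u v s b|u v r rr].
- exact: pres_refl.
- exact: pres_sym.
- exact: pres_trans uv.
- by rewrite !(catA w); exact: pres_cancel.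
- by rewrite !(catA w); exact: pres_relator.
Qed.

Lemma pres_catr w u v : pres_rel u v -> pres_rel (u ++ w) (v ++ w).
Proof.
elim=> {u v} [u|u v _|v u x _ uv _|u v s b|u v r rr].
- exact: pres_refl.
- exact: pres_sym.
- exact: pres_trans uv.
- by rewrite -!catA; exact: pres_cancel.
- by rewrite -!catA; exact: pres_relator.
Qed.

Lemma pres_cat u u' v v' :
  pres_rel u u' -> pres_rel v v' -> pres_rel (u ++ v) (u' ++ v').
Proof.
by move=> uu' vv'; apply: (pres_trans (pres_catr v uu')); exact: pres_catl.
Qed.

Lemma inv_wordK : involutive (@inv_word S).
Proof.
move=> u; rewrite /inv_word map_rev revK -map_comp.
by rewrite -[RHS]map_id; apply: eq_map => -[s b] /=; rewrite negbK.
Qed.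

Lemma pres_invr u : pres_rel (u ++ inv_word u) [::].
Proof.
elim: u => [|[s b] u IH]; first exact: pres_refl.
rewrite /inv_word /= rev_cons -cats1 -/(inv_word u).
apply: (@pres_trans ([:: (s, b)] ++ [::] ++ [:: (s, ~~ b)])); last first.
  exact: (@pres_cancel [::] [::]).
apply: (@pres_catl [:: (s, b)]).
by rewrite catA; apply: pres_catr.
Qed.

Lemma pres_invl u : pres_rel (inv_word u ++ u) [::].
Proof. by rewrite -{2}(inv_wordK u); exact: pres_invr. Qed.

Definition pres_one := pres_pi [::].
Definition pres_mul (x y : pres_group) := pres_pi (repr x ++ repr y).
Definition pres_inv (x : pres_group) := pres_pi (inv_word (repr x)).

Lemma pres_mulA : associative pres_mul.
Proof.
move=> x y z; apply/pres_piP.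
apply: (pres_trans (pres_catl _ (pres_reprK _))).
rewrite catA; apply: pres_catr; exact/pres_sym/pres_reprK.
Qed.

Lemma pres_mul1 : left_id pres_one pres_mul.
Proof.
move=> x; rewrite -[RHS]pres_piK; apply/pres_piP.
exact: pres_catr (pres_reprK [::]).
Qed.

Lemma pres_mulr1 : right_id pres_one pres_mul.
Proof.
move=> x; rewrite -[RHS]pres_piK; apply/pres_piP.
by rewrite -[X in pres_rel _ X]cats0; apply/pres_catl/pres_reprK.
Qed.

Lemma pres_mulV : left_inverse pres_one pres_inv pres_mul.
Proof.
move=> x; apply/pres_piP.
exact: (pres_trans (pres_catr _ (pres_reprK _)) (pres_invl _)).
Qed.

Lemma pres_mulrV : right_inverse pres_one pres_inv pres_mul.
Proof.
move=> x; apply/pres_piP.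
exact: (pres_trans (pres_catl _ (pres_reprK _)) (pres_invr _)).
Qed.

HB.instance Definition _ := isGroup.Build pres_group
  pres_mulA pres_mul1 pres_mulr1 pres_mulV pres_mulrV.

End Presentation.

(* The labels of two-element sets that are not edges are irrelevant. *)
Record coxeter_graph := CoxeterGraph {
  vertex : finType;
  edges : {set {set vertex}};
  label : {set vertex} -> nat;
  edges_card2 : forall e, e \in edges -> #|e| = 2;
  label_ge2 : forall e, e \in edges -> (2 <= label e)%N
}.

Definition word_power (S : choiceType) (u : word S) n : word S :=
  flatten (nseq n u).

Inductive coxeter_relator (Gamma : coxeter_graph) :
    word (vertex Gamma) -> Prop :=
| square_relator v : coxeter_relator (word_power [:: (v, false)] 2)
| edge_relator v w : [set v; w]%SET \in edges Gamma ->
    coxeter_relator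
      (word_power [:: (v, false); (w, false)] (label [set v; w]%SET)).

Definition coxeter_group (Gamma : coxeter_graph) : groupType :=
  pres_group (@coxeter_relator Gamma).

Section Automorphisms.
Context (G : groupType).

Record aut := Aut {
  aut_fun :> G -> G;
  aut_inv : G -> G;
  aut_funK : cancel aut_fun aut_inv;
  aut_invK : cancel aut_inv aut_fun;
  autM : {morph aut_fun : x y / x * y}
}.

HB.instance Definition _ := gen_eqMixin aut.
HB.instance Definition _ := gen_choiceMixin aut.

Lemma autP (f g : aut) : f =1 g -> f = g.
Proof.
case: f g => [f f' fK f'K fM] [g g' gK g'K gM] /= fg.
have {}fg : f = g by apply/funext.
have f'g' : f' = g' by apply/funext => x; rewrite -{1}[x]g'K -fg fK.
subst g g'; congr Aut; exact: Prop_irrelevance.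
Qed.

Definition aut_one : aut := @Aut id id (fun=> erefl) (fun=> erefl)
  (fun _ _ => erefl).

Definition aut_mul (f g : aut) : aut.
Proof.
apply: (@Aut (f \o g) (aut_inv g \o aut_inv f)).
- exact: can_comp (aut_funK f) (aut_funK g).
- exact: can_comp (aut_invK g) (aut_invK f).
- by move=> x y /=; rewrite !autM.
Defined.

Definition aut_inverse (f : aut) : aut.
Proof.
apply: (@Aut (aut_inv f) f (aut_invK f) (aut_funK f)).
by move=> x y; rewrite -{1}[x](aut_invK f) -{1}[y](aut_invK f) -autM aut_funK.
Defined.

Lemma aut_mulA : associative aut_mul. Proof. by move=> f g h; apply: autP. Qed.
Lemma aut_mul1 : left_id aut_one aut_mul. Proof. by move=> f; apply: autP. Qed.
Lemma aut_mulr1 : right_id aut_one aut_mul.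
Proof. by move=> f; apply: autP. Qed.
Lemma aut_mulV : left_inverse aut_one aut_inverse aut_mul.
Proof. by move=> f; apply: autP => x /=; rewrite aut_funK. Qed.
Lemma aut_mulrV : right_inverse aut_one aut_inverse aut_mul.
Proof. by move=> f; apply: autP => x /=; rewrite aut_invK. Qed.

HB.instance Definition _ := isGroup.Build aut
  aut_mulA aut_mul1 aut_mulr1 aut_mulV aut_mulrV.

End Automorphisms.

Definition finite_index_subgroup (G : groupType) (H : {pred G}) :=
  group_closed H /\
  finite_set (range (fun g : G => [set g * h | h in [set` H]])).

(* A homomorphism defined on a subgroup H of G is given by a function on G of
   which only the values on H matter. *)
Definition subgroup_surjects (G K : groupType) (H : {pred G}) :=
  exists f : G -> K,
    {in H &, {morph f : x y / x * y}} /\ set_surj [set` H] [set: K] f.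

Definition subgroup_surjects_Z (G : groupType) (H : {pred G}) :=
  exists f : G -> int,
    {in H &, {morph f : x y / x * y >-> (x + y)%R}} /\
    set_surj [set` H] [set: int] f.

Definition virtually_indicable (G : groupType) :=
  exists H : {pred G}, finite_index_subgroup H /\ subgroup_surjects_Z H.

Definition in_class_W (Gamma : coxeter_graph) :=
  exists H : {pred aut (coxeter_group Gamma)},
    finite_index_subgroup H /\
    exists Delta : coxeter_graph,
      infinite_set [set: coxeter_group Delta] /\
      subgroup_surjects (coxeter_group Delta) H.

Local Open Scope ring_scope.

Record affine_isometric_action (R : realType) (G : groupType)
    (E : normedModType R) (act : G -> E -> E) : Prop := {
  action1 : forall x, act 1%g x = x;
  actionM : forall g h x, act (g * h)%g x = act g (act h x);
  action_isometry : forall g x y, `|act g x - act g y| = `|x - y|;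
  action_affine : forall g t x y,
    act g (t *: x + (1 - t) *: y) = t *: act g x + (1 - t) *: act g y
}.

(* A real Hilbert space is a Banach space E whose norm comes from an inner
   product. The group is meant to be countable, as Aut(W) is for a finitely
   generated group W. *)
Definition property_T (R : realType) (G : groupType) :=
  forall (E : completeNormedModType R) (dot : {dot E for idfun}),
    (forall x, dot x x = `|x| ^+ 2) ->
    forall act : G -> E -> E, affine_isometric_action act ->
    exists x, forall g, act g x = x.

(* Main.v *)
(** The label-m edges of a Coxeter graph give, over a finite field F of odd
    characteristic containing primitive 2m-th roots of unity, an analogue of the
    reflection representation of W.  Recording which vectors +-g(e_s) of the
    finite space V = F^S are crossed along a word yields a cocycle from W to the
    odd integer functions on V; on the kernel K of the representation, which
    has finite index, it is a homomorphism to a free abelian group.  If it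
    vanished on K, it would descend to the finite image of W, where averaging
    makes it a coboundary, i.e. splits the roots over F into positive and
    negative ones.  Then the image satisfies the exchange condition, and
    Matsumoto's argument shows that W embeds in it.  So if W is infinite, K maps
    onto Z.  This pulls back to Aut(W_Gamma), and a homomorphism onto Z from a
    subgroup of finite index n induces an action by affine isometries on R^n
    without fixed point. *)

Require Import Defs.
From HB Require Import structures.
From mathcomp Require Import all_boot all_order all_algebra.
From mathcomp Require Import cyclic finfield.
From mathcomp Require Import boolp classical_sets functions cardinality reals.
From mathcomp Require Import ring lra zify.
From mathcomp Require Import topology normedtype.

Set Implicit Arguments.
Unset Strict Implicit.
Unset Printing Implicit Defensive.

Import Order.TTheory GRing.Theory Num.Theory.
Import numFieldNormedType.Exports.

Local Open Scope ring_scope.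

(** * Cyclotomy over finite fields *)

(** For a prime [p > max(N, 2)], Euler's theorem gives that [N] divides [p ^ totient N - 1]. The
    cyclic group of units of the field with [p ^ totient N] elements then has primitive roots of
    every order dividing [N]. *)
Lemma finite_field_with_roots (N : nat) : (0 < N)%N ->
  exists F : finFieldType, (2 : F) != 0 /\
    forall m, (m %| N)%N -> exists eta : F, m.-primitive_root eta.
Proof.
move=> N0; have [p pN pr_p] := prime_above (maxn N 2).
have [p_gtN p_gt2] : (N < p /\ 2 < p)%N by move: pN; rewrite gtn_max => /andP.
have k0 : (0 < totient N)%N by rewrite totient_gt0.
have [F pF cardF] := pPrimePowerField pr_p k0.
exists F; split.
  rewrite -(dvdn_pcharf pF); apply/negP => /(@dvdn_leq _ 2 isT).
  by rewrite leqNgt p_gt2.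
have copN : coprime p N.
  by rewrite prime_coprime//; apply/negP => /(dvdn_leq N0); rewrite leqNgt p_gtN.
have F1 : (0 < #|F|.-1)%N.
  by rewrite -subn1 subn_gt0; exact: finNzRing_gt1.
have NF : (N %| #|F|.-1)%N.
  rewrite -subn1 cardF -eqn_mod_dvd ?expn_gt0 ?prime_gt0//.
  by apply/eqP; exact: Euler_exp_totient.
have [z zP] : exists z : F, #|F|.-1.-primitive_root z.
  have : has #|F|.-1.-primitive_root (enum (predC1 (0 : F))).
    apply: has_prim_root => //; last 2 first.
    - exact: enum_uniq.
    - by rewrite -cardE cardC1.
    apply/allP => x; rewrite mem_enum inE => x0.
    rewrite unity_rootE -(inj_eq (mulfI x0)) mulr1 -exprS prednK ?expf_card//.
    exact: ltnW (finNzRing_gt1 F).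
  by case/hasP => z _ zP; exists z.
move=> m mN; exists (z ^+ (#|F|.-1 %/ m)).
exact/dvdn_prim_root/(dvdn_trans mN).
Qed.

Section Chebyshev.
Context (F : fieldType).
Implicit Types c eta : F.

(* For [c = eta + eta^-1] this is the quantum integer
   [(eta^n - eta^-n) / (eta - eta^-1)]. *)
Fixpoint cheb c n : F :=
  if n is n'.+1 then (if n' is n''.+1 then c * cheb c n' - cheb c n'' else 1) else 0.

Lemma chebSS c n : cheb c n.+2 = c * cheb c n.+1 - cheb c n.
Proof. by []. Qed.

Lemma cheb2 n : cheb 2 n = n%:R.
Proof.
suff : cheb 2 n = n%:R /\ cheb 2 n.+1 = n.+1%:R by case.
elim: n => [//|n [IHn IHn1]]; split=> //.
by rewrite chebSS IHn IHn1 -!natr1; ring.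
Qed.

Lemma chebE eta n : eta != 0 ->
  (eta - eta^-1) * cheb (eta + eta^-1) n = eta ^+ n - eta^-1 ^+ n.
Proof.
move=> eta0; set c := eta + eta^-1.
suff : (eta - eta^-1) * cheb c n = eta ^+ n - eta^-1 ^+ n /\
  (eta - eta^-1) * cheb c n.+1 = eta ^+ n.+1 - eta^-1 ^+ n.+1 by case.
elim: n => [|n [IHn IHn1]]; first by rewrite /= mulr0 subrr mulr1.
split=> //; rewrite chebSS mulrBr mulrCA IHn IHn1 /c !exprS.
by field.
Qed.

Context (m : nat) (eta : F).
Hypotheses (m_gt1 : (1 < m)%N) (eta_prim : (2 * m).-primitive_root eta).

Let eta_neq0 : eta != 0.
Proof. by rewrite (prim_root_eq0 eta_prim); lia. Qed.

Let eta2_neq1 : eta ^+ 2 != 1.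
Proof.
rewrite -(prim_order_dvd eta_prim); apply/negP => /(@dvdn_leq _ 2 isT).
by move: m_gt1; lia.
Qed.

Let etaB_neq0 : eta - eta^-1 != 0.
Proof.
have -> : eta - eta^-1 = (eta ^+ 2 - 1) / eta by field.
by rewrite mulf_neq0 ?subr_eq0 ?invr_eq0.
Qed.

Let etam : eta ^+ m = -1.
Proof.
have /eqP : eta ^+ m ^+ 2 = 1 by rewrite -exprM mulnC prim_expr_order.
rewrite sqrf_eq1 => /orP[|/eqP//].
rewrite -(prim_order_dvd eta_prim) => /dvdn_leq.
by move: m_gt1; lia.
Qed.

Let etaVm : eta^-1 ^+ m = -1.
Proof. by rewrite exprVn etam invrN1. Qed.

(** [eta ^+ m] is a square root of 1 other than 1, so the shift by [m] multiplies both powers in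
    [chebE] by -1. *)
Lemma cheb_antiperiodic n : cheb (eta + eta^-1) (n + m) = - cheb (eta + eta^-1) n.
Proof.
apply: (mulfI etaB_neq0); rewrite mulrN !chebE// !exprD etam etaVm.
by rewrite !mulrN1 opprB addrC opprK.
Qed.

Lemma cheb_eq0 n : cheb (eta + eta^-1) n = 0 -> (m %| n)%N.
Proof.
move=> n0; have := chebE n eta_neq0; rewrite n0 mulr0 => /esym/eqP.
rewrite subr_eq0 exprVn -(inj_eq (mulIf (expf_neq0 n eta_neq0))).
rewrite mulVf ?expf_neq0// -expr2 -exprM -(prim_order_dvd eta_prim).
by rewrite [(n * 2)%N]mulnC dvdn_pmul2l.
Qed.

(** By [chebE] this is a difference of two geometric series, whose ratios [eta ^+ 2] and
    [eta^-1 ^+ 2] differ from 1 and have [m]-th power 1. *)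
Lemma cheb_sum a : \sum_(k < m) cheb (eta + eta^-1) (k.*2 + a) = 0.
Proof.
apply: (mulfI etaB_neq0); rewrite mulr0 mulr_sumr.
under eq_bigr do rewrite chebE// !exprD -mul2n !exprM.
rewrite sumrB -!mulr_suml.
have geom (x : F) : x ^+ 2 != 1 -> x ^+ m = -1 -> \sum_(k < m) x ^+ 2 ^+ k = 0.
  move=> x2 xm; apply: (@mulfI _ (x ^+ 2 - 1)); first by rewrite subr_eq0.
  by rewrite -subrX1 -exprM mulnC exprM xm sqrrN expr1n subrr mulr0.
by rewrite !geom// ?exprVn ?invr_eq1// !mul0r subrr.
Qed.

End Chebyshev.

(** * The reflection representation and the crossing cocycle *)

Section Words.
Context (S : eqType).
Implicit Types s t : S.

(* The last letter is [s], also when [k] is even. *)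
Fixpoint alt s t k : seq S :=
  if k is k'.+1 then (if odd k' then t else s) :: alt s t k' else [::].

Lemma size_alt s t k : size (alt s t k) = k.
Proof. by elim: k => //= k ->. Qed.

Lemma altS_rcons s t k : alt s t k.+1 = rcons (alt t s k) s.
Proof.
elim: k => // k IH.
rewrite -[LHS]/((if odd k.+1 then t else s) :: alt s t k.+1) IH /=.
by case: (odd k).
Qed.

Lemma alt_double s t k : alt t s k.*2 = flatten (nseq k [:: s; t]).
Proof.
by elim: k => //= k <-; rewrite odd_double.
Qed.

(** This turns a relator [(st)^k] into a braid relation between two alternating words. *)
Lemma rev_alt_cat s t k : rev (alt s t k) ++ alt t s k = flatten (nseq k [:: s; t]).
Proof.
elim: k s t => // k IH s t.
rewrite !altS_rcons rev_rcons -cats1 cat_cons catA IH.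
by elim: k {IH} => //= k ->.
Qed.

Lemma alt_split s t k u a v : alt s t k = u ++ a :: v ->
  [/\ (size v < k)%N, v = alt s t (size v) & a = if odd (size v) then t else s].
Proof.
elim: k u => [|k IH] [|b u] //=.
  by case=> <- <-; rewrite size_alt.
by case=> _ /IH[vk vE aE]; split=> //; exact: ltnW.
Qed.

End Words.

Section Reflections.
Context (S : finType) (F : finFieldType) (c : S -> S -> F).
Hypothesis cC : forall s t, c s t = c t s.

Local Notation V := {ffun S -> F^o}.
Implicit Types (s t : S) (u v w : seq S) (x y : V).

Definition simple_root s : V := [ffun t => (t == s)%:R].
Local Notation e := simple_root.

(** Twice the usual Tits form: with 2 on the diagonal, reflections need no division. *)
Definition gram s t : F := if s == t then 2 else - c s t.

Definition coroot s x : F := \sum_t gram s t * x t.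
Definition form x y : F := \sum_s x s * coroot s y.
Definition refl s x : V := x - coroot s x *: e s.
Definition act w x : V := foldr refl x w.

Lemma corootD s x y : coroot s (x + y) = coroot s x + coroot s y.
Proof. by rewrite -big_split; apply: eq_bigr => t _; rewrite ffunE mulrDr. Qed.

Lemma corootZ s a x : coroot s (a *: x) = a * coroot s x.
Proof.
by rewrite mulr_sumr; apply: eq_bigr => t _; rewrite ffunE mulrCA.
Qed.

Lemma coroot_simple s t : coroot s (e t) = gram s t.
Proof.
rewrite /coroot (bigD1 t)//= ffunE eqxx mulr1 big1 ?addr0// => r rt.
by rewrite ffunE (negPf rt) mulr0.
Qed.

Lemma gramC s t : gram s t = gram t s.
Proof. by rewrite /gram eq_sym cC. Qed.

Lemma formC x y : form x y = form y x.
Proof.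
rewrite /form; under eq_bigr do rewrite mulr_sumr.
rewrite exchange_big; apply: eq_bigr => s _; rewrite mulr_sumr.
by apply: eq_bigr => t _; rewrite gramC mulrCA mulrA mulrC.
Qed.

Lemma formDr x y z : form x (y + z) = form x y + form x z.
Proof. by rewrite -big_split; apply: eq_bigr => s _; rewrite corootD mulrDr. Qed.

Lemma formZr a x y : form x (a *: y) = a * form x y.
Proof.
by rewrite mulr_sumr; apply: eq_bigr => s _; rewrite corootZ mulrCA.
Qed.

Lemma form_simple s y : form (e s) y = coroot s y.
Proof.
rewrite /form (bigD1 s)//= ffunE eqxx mul1r big1 ?addr0// => r rt.
by rewrite ffunE (negPf rt) mul0r.
Qed.

Lemma refl_linear s a x y : refl s (a *: x + y) = a *: refl s x + refl s y.
Proof.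
rewrite /refl corootD corootZ scalerDl opprD scalerBr scalerA addrACA.
by [].
Qed.

Lemma form_refl s x y : form (refl s x) (refl s y) = form x y.
Proof.
rewrite /refl -!scaleN1r !scalerA !formDr !formZr ![form (_ + _) _]formC.
rewrite !formDr !formZr !form_simple coroot_simple /gram eqxx.
by rewrite [form y (e s)]formC form_simple [form y x]formC; ring.
Qed.

Lemma reflK s : involutive (refl s).
Proof.
move=> x; rewrite /refl -!scaleN1r corootD !corootZ coroot_simple /gram eqxx.
by apply/ffunP => t; rewrite !ffunE /GRing.scale /=; ring.
Qed.

Lemma refl_simple s : refl s (e s) = - e s.
Proof.
rewrite /refl coroot_simple /gram eqxx.
by apply/ffunP => t; rewrite !ffunE /GRing.scale /=; ring.
Qed.

Lemma act_cat u v x : act (u ++ v) x = act u (act v x).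
Proof. by rewrite /act foldr_cat. Qed.

Lemma act_rcons w s x : act (rcons w s) x = act w (refl s x).
Proof. by rewrite -cats1 act_cat. Qed.

Lemma act_revK w x : act w (act (rev w) x) = x.
Proof.
elim: w x => //= s w IH x; rewrite rev_cons act_rcons IH; exact: reflK.
Qed.

Lemma act_rev w x : act (rev w) (act w x) = x.
Proof. by rewrite -{2}(revK w) act_revK. Qed.

Lemma act_linear w a x y : act w (a *: x + y) = a *: act w x + act w y.
Proof. by elim: w => //= s w ->; rewrite refl_linear. Qed.

Lemma act0 w : act w 0 = 0.
Proof.
have /eqP := act_linear w 1 0 0; rewrite !scale1r addr0.
by rewrite -{1}[act w 0]addr0 (inj_eq (addrI _)) eq_sym => /eqP.
Qed.

Lemma actN w x : act w (- x) = - act w x.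
Proof. by have := act_linear w (-1) x 0; rewrite !scaleN1r act0 !addr0. Qed.

Lemma reflN s x : refl s (- x) = - refl s x.
Proof. exact: (actN [:: s]). Qed.

Lemma form_act w x y : form (act w x) (act w y) = form x y.
Proof. by elim: w => //= s w IH; rewrite form_refl. Qed.

Lemma act_conj_refl w s t x : act w (e s) = e t ->
  act w (refl s x) = refl t (act w x).
Proof.
move=> wst; rewrite {1}/refl addrC -scaleNr act_linear wst scaleNr addrC.
by rewrite /refl -(form_simple t) -wst form_act form_simple.
Qed.

(** In the plane of [e s] and [e t], each reflection performs one step of the recurrence of
    [cheb]. *)
Lemma act_alt s t k : s != t -> act (alt t s k) (e s) =
  cheb (c s t) k.+1 *: e (if odd k then t else s) +
  cheb (c s t) k *: e (if odd k then s else t).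
Proof.
move=> st; elim: k => [|k IH]; first by rewrite scale1r scale0r addr0.
rewrite chebSS [LHS]/= {}IH oddS if_neg.
set a := cheb _ k.+1; set b := cheb _ k.
have step p q : p != q -> c p q = c s t ->
    refl p (a *: e q + b *: e p) = (c s t * a - b) *: e p + a *: e q.
  move=> pq cpq; rewrite refl_linear /refl corootZ !coroot_simple /gram eqxx.
  rewrite (negPf pq) cpq; apply/ffunP => r; rewrite !ffunE /GRing.scale /=.
  by ring.
by case: (odd k) => /=; apply: step => //; rewrite eq_sym.
Qed.

End Reflections.

Section Crossing.
Context (S : finType) (F : finFieldType) (c : S -> S -> F).

Local Notation V := {ffun S -> F^o}.
Implicit Types (s t : S) (u v w : seq S) (x y : V).
Local Notation e := (@simple_root S F).
Local Notation act := (act c).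
Local Notation refl := (refl c).

(** The second term makes this odd in both arguments, so a root and its negative stand for one wall
    crossed in opposite directions. *)
Definition delta x y : int := (y == x)%:R - (y == - x)%:R.

Lemma deltaNl x y : delta (- x) y = - delta x y.
Proof. by rewrite /delta opprK opprB. Qed.

Lemma deltaNr x y : delta x (- y) = - delta x y.
Proof. by rewrite /delta eqr_oppLR eqr_opp opprB. Qed.

(** For [w = s1 ... sk] this adds up [delta] of the roots [s1 ... s(i-1) e(si)], the ones crossed
    along the gallery of [w]. *)
Fixpoint crossing w x : int :=
  if w is s :: w' then delta (e s) x + crossing w' (refl s x) else 0.

(** The cocycle identity, words acting on functions on [V] by precomposition with the inverse. *)
Lemma crossing_cat u v x :
  crossing (u ++ v) x = crossing u x + crossing v (act (rev u) x).
Proof.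
elim: u x => [|s u IH] x /=; first by rewrite add0r.
by rewrite IH addrA rev_cons act_rcons.
Qed.

Lemma crossing_rcons w s x :
  crossing (rcons w s) x = crossing w x + delta (act w (e s)) x.
Proof.
rewrite -cats1 crossing_cat /= addr0 /delta; congr (_ + (_%:R - _%:R)).
  by rewrite -(can_eq (act_rev c w)) act_revK.
by rewrite -(can_eq (act_rev c w)) act_revK// actN.
Qed.

Lemma crossingN w x : crossing w (- x) = - crossing w x.
Proof.
elim: w x => [|s w IH] x /=; first by rewrite oppr0.
by rewrite deltaNr reflN IH [RHS]opprD.
Qed.

End Crossing.

(** * The exchange condition *)

Section Exchange.
Context (S : finType) (F : finFieldType) (c : S -> S -> F).
Hypothesis cC : forall s t, c s t = c t s.

Local Notation V := {ffun S -> F^o}.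
Implicit Types (s t : S) (u v w : seq S) (x y : V).
Local Notation e := (@simple_root S F).
Local Notation act := (act c).
Local Notation refl := (refl c).
Local Notation crossing := (crossing c).

Hypothesis two_neq0 : (2 : F) != 0.
(** Assumed in order to be refuted for infinite groups; until then it makes the cocycle depend only
    on the action of a word. *)
Hypothesis crossing_ker : forall w, act w =1 id -> crossing w =1 (fun=> 0).

Lemma simple_root_neqN s : e s != - e s.
Proof.
apply: contra two_neq0 => /eqP/ffunP/(_ s); rewrite !ffunE eqxx => /eqP.
by rewrite -subr_eq0 opprK.
Qed.

Lemma act_rev_eq u v : act u =1 act v -> act (rev u) =1 act (rev v).
Proof. by move=> uv x; rewrite -{1}(act_revK c v x) -uv act_rev. Qed.

Lemma crossing_act u v : act u =1 act v -> crossing u =1 crossing v.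
Proof.
move=> uv x.
(* If [w] acts as [v], then [w ++ rev v] acts trivially. *)
have kerv w : act w =1 act v -> crossing w x + crossing (rev v) (act (rev v) x) = 0.
  move=> wv; rewrite -(act_rev_eq wv) -crossing_cat crossing_ker// => y.
  by rewrite act_cat wv act_revK.
by apply: (addIr (crossing (rev v) (act (rev v) x))); rewrite !kerv.
Qed.

Let image : {set {ffun V -> V}} :=
  [set q : {ffun V -> V} | `[< exists w, q =1 act w >]].
(** The default [[::]] is reached only for [q] outside [image]. *)
Let word_of (q : {ffun V -> V}) : seq S :=
  xget [::] [set w | q =1 act w]%classic.

Let word_ofP w (q : {ffun V -> V}) : q =1 act w -> act (word_of q) =1 act w.
Proof.
move=> qw x; rewrite -qw.
by have /= -> := xgetPex [::] (ex_intro [set w | q =1 act w]%classic w qw).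
Qed.

(* By [crossing_ker], [crossing] is a cocycle on the finite image of [act];
   averaging exhibits it, up to a factor, as the coboundary of [height]. *)
Definition height x : int := \sum_(q in image) crossing (word_of q) x.

Lemma heightN x : height (- x) = - height x.
Proof. by rewrite -sumrN; apply: eq_bigr => q _; rewrite crossingN. Qed.

(** Composition with [refl s] permutes [image], and prefixing the letter [s] contributes
    [delta (e s) x] to each summand. *)
Lemma height_refl s x : height x = delta (e s) x *+ #|image| + height (refl s x).
Proof.
pose h (q : {ffun V -> V}) : {ffun V -> V} := [ffun v => refl s (q v)].
have hK : involutive h by move=> q; apply/ffunP => v; rewrite !ffunE reflK.
have hq q : q \in image -> h q \in image /\
    crossing (word_of (h q)) x = delta (e s) x + crossing (word_of q) (refl s x).
  rewrite inE => /asboolP[w qw].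
  have hw : h q =1 act (s :: w) by move=> v; rewrite ffunE qw.
  rewrite inE; split; first by apply/asboolP; exists (s :: w).
  by rewrite (crossing_act (word_ofP hw)) (crossing_act (word_ofP qw)).
have him q : (h q \in image) = (q \in image).
  by apply/idP/idP => /hq[]//; rewrite hK.
rewrite {1}/height (reindex_inj (can_inj hK)) /=.
rewrite (eq_bigl _ _ him) -sumr_const -big_split /=.
by apply: eq_bigr => q /hq[].
Qed.

(** At [x = e s], oddness turns [height_refl] into [2 * height (e s) = #|image|]. *)
Lemma height_simple_gt0 s : 0 < height (e s).
Proof.
have := height_refl s (e s).
rewrite refl_simple heightN /delta eqxx (negPf (simple_root_neqN s)) subr0.
have : (0 < #|image|)%N.
  apply/card_gt0P; exists [ffun v => v]; rewrite inE; apply/asboolP.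
  by exists [::] => v; rewrite ffunE.
by rewrite mulr1n; lia.
Qed.

(** The analogue of the fact that a simple reflection permutes the positive roots other than its
    own. *)
Lemma height_refl_neq s x : x != e s -> x != - e s ->
  height (refl s x) = height x.
Proof.
move=> xs xNs; rewrite (height_refl s x) /delta (negPf xs) (negPf xNs).
by rewrite subrr mul0rn add0r.
Qed.

Lemma height_root_neq0 w s : height (act w (e s)) != 0.
Proof.
elim: w => [|t w IH] /=; first by rewrite gt_eqF// height_simple_gt0.
have [->|xt] := eqVneq (act w (e s)) (e t).
  by rewrite refl_simple heightN oppr_eq0 gt_eqF// height_simple_gt0.
have [->|xNt] := eqVneq (act w (e s)) (- e t).
  by rewrite reflN refl_simple opprK gt_eqF// height_simple_gt0.
by rewrite height_refl_neq.
Qed.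

(** As the letters of [w] are applied from the right, the root [e s] starts positive and ends
    negative. A letter [a] makes only the positive root [e a] negative, so at the switch the suffix
    conjugates [s] to that letter, which cancels. *)
Lemma exchange w s : height (act w (e s)) < 0 ->
  exists w1 t w2, [/\ w = w1 ++ t :: w2, act w2 (e s) = e t
    & act (rcons w s) =1 act (w1 ++ w2)].
Proof.
elim: w => [|a w IH]; first by rewrite /= ltNge ltW// height_simple_gt0.
have [w_lt0 _|w_gt0 aw_lt0] := ltP (height (act w (e s))) 0.
  have [w1 [t [w2 [-> w2s w12]]]] := IH w_lt0.
  exists (a :: w1), t, w2; split=> // x.
  by rewrite rcons_cons /= -w12.
have wsa : act w (e s) = e a.
  have [//|xa] := eqVneq (act w (e s)) (e a).
  have [xNa|xNa] := eqVneq (act w (e s)) (- e a).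
    by move: w_gt0; rewrite xNa heightN oppr_ge0 leNgt height_simple_gt0.
  by move: aw_lt0; rewrite /= height_refl_neq// ltNge w_gt0.
exists [::], a, w; split=> // x.
by rewrite act_rcons/= (act_conj_refl cC _ wsa) reflK.
Qed.

(** Length is minimised over words with the same action, not over words with the same class in W,
    because the action is not yet known to be faithful. *)
Definition reduced w := forall u, act u =1 act w -> (size w <= size u)%N.

Lemma reduced_catl u v : reduced (u ++ v) -> reduced u.
Proof.
move=> uvr u' u'u; have /uvr : act (u' ++ v) =1 act (u ++ v).
  by move=> x; rewrite !act_cat.
by rewrite !size_cat leq_add2r.
Qed.

Lemma reduced_act_eq u v : reduced u -> act v =1 act u ->
  (size v <= size u)%N -> reduced v.
Proof.
move=> ur vu vsu w wv; apply: (leq_trans vsu); apply: ur => x.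
by rewrite wv vu.
Qed.

Lemma reduced_exists w : exists2 u, reduced u & act u =1 act w.
Proof.
pose P n := `[< exists u, size u = n /\ act u =1 act w >].
have exP : exists n, P n by exists (size w); apply/asboolP; exists w.
case: (ex_minnP exP) => n /asboolP[u [<- uw]] umin; exists u => // v vu.
by apply: umin; apply/asboolP; exists v; split=> // x; rewrite vu.
Qed.

(** If the root were negative, [exchange] would shorten [rcons w s] by two letters. *)
Lemma reduced_rcons_gt0 w s : reduced (rcons w s) -> 0 < height (act w (e s)).
Proof.
move=> wsr; rewrite lt_neqAle eq_sym height_root_neq0 leNgt.
apply/negP => /exchange[w1 [t [w2 [wE _ /fsym/wsr]]]].
by rewrite wE size_rcons !size_cat /=; lia.
Qed.

Lemma gt0_reduced_rcons w s : reduced w -> 0 < height (act w (e s)) ->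
  reduced (rcons w s).
Proof.
move=> wr ws; have [u ur uws] := reduced_exists (rcons w s).
(* Exchange will delete a letter of [u] and leave a word acting as the reduced word [w]. *)
suff wu : (size w < size u)%N.
  by move=> v vws; rewrite size_rcons (leq_trans wu)// ur// => x; rewrite vws uws.
have : height (act u (e s)) < 0.
  by rewrite uws act_rcons refl_simple actN heightN oppr_lt0.
move=> /exchange[u1 [t [u2 [uE _ u12]]]].
have : act (u1 ++ u2) =1 act w.
  by move=> x; rewrite -u12 act_rcons uws act_rcons reflK.
by move=> /wr; rewrite uE !size_cat /=; lia.
Qed.

End Exchange.

(** * Coxeter groups and Matsumoto's argument *)

Lemma cat_eq_cat_cons (T : Type) (x y w1 w2 : seq T) a :
  x ++ y = w1 ++ a :: w2 ->
  (exists2 x', x = w1 ++ a :: x' & w2 = x' ++ y) \/ (exists y', y = y' ++ a :: w2).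
Proof.
elim: x w1 => [|b x IH] [|b' w1] /=.
- by move=> ->; right; exists [::].
- by move=> ->; right; exists (b' :: w1).
- by case=> -> <-; left; exists x.
- by case=> -> /IH[[x' -> ->]|[y' ->]]; [left; exists x'|right; exists y'].
Qed.

Section CoxeterWords.
Context (Gamma : coxeter_graph).
Local Notation S := (vertex Gamma).
Local Open Scope group_scope.

Lemma pres_pi_cat (T : choiceType) (rel : word T -> Prop) (u v : word T) :
  pres_pi rel (u ++ v) = pres_pi rel u * pres_pi rel v.
Proof. by apply/pres_piP/pres_cat; apply/pres_sym/pres_reprK. Qed.

Definition word_class (w : seq S) : coxeter_group Gamma :=
  pres_pi (@coxeter_relator Gamma) [seq (s, false) | s <- w].

Lemma word_class_cat u v : word_class (u ++ v) = word_class u * word_class v.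
Proof. by rewrite /word_class map_cat pres_pi_cat. Qed.

Lemma word_class_sq s : word_class [:: s] * word_class [:: s] = 1.
Proof.
rewrite -word_class_cat; apply/pres_piP.
exact: (@pres_relator _ _ [::] [::] _ (square_relator s)).
Qed.

Lemma word_class_rev w : word_class (rev w) = (word_class w)^-1.
Proof.
apply: (mulIg (word_class w)); rewrite mulVg.
elim: w => [|s w IH]; first by rewrite -word_class_cat.
rewrite rev_cons -cats1 -(cat1s s w) !word_class_cat -mulgA (mulgA (word_class [:: s])).
by rewrite word_class_sq mul1g.
Qed.

Lemma word_class_edge s t : [set s; t]%SET \in edges Gamma ->
  word_class (flatten (nseq (label [set s; t]%SET) [:: s; t])) = 1.
Proof.
move=> st; apply/pres_piP; rewrite map_flatten map_nseq.
by have := @pres_relator _ _ [::] [::] _ (edge_relator st); rewrite cats0.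
Qed.

Lemma word_class_braid s t : [set s; t]%SET \in edges Gamma ->
  word_class (alt s t (label [set s; t]%SET)) =
  word_class (alt t s (label [set s; t]%SET)).
Proof.
move=> st; apply: (mulgI (word_class (alt s t (label [set s; t]%SET)))^-1).
by rewrite mulVg -word_class_rev -word_class_cat rev_alt_cat word_class_edge.
Qed.

Lemma word_class_letters (u : word S) :
  pres_pi (@coxeter_relator Gamma) u = word_class (unzip1 u).
Proof.
elim: u => [//|[s b] u IH].
rewrite -cat1s pres_pi_cat IH /= -(cat1s s) word_class_cat; congr (_ * _).
case: b => //; apply: (mulIg (word_class [:: s])); rewrite word_class_sq.
rewrite -pres_pi_cat; apply/pres_piP.
exact: (@pres_cancel _ _ [::] [::] s true).
Qed.

Lemma word_class_repr (x : coxeter_group Gamma) : word_class (unzip1 (repr x)) = x.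
Proof. by rewrite -word_class_letters pres_piK. Qed.

End CoxeterWords.

(** * Relators act trivially and have trivial crossing *)

Section Representation.
Context (Gamma : coxeter_graph) (F : finFieldType) (eta : {set vertex Gamma} -> F).
Local Notation S := (vertex Gamma).
Local Notation V := {ffun S -> F^o}.
Implicit Types (s t : S) (u v w : seq S) (x y : V).
Local Notation e := (@simple_root S F).

Hypothesis eta_prim : forall a, a \in edges Gamma ->
  (2 * label a).-primitive_root (eta a).

(* The analogue in [F] of [2 cos (pi / m)], with [m = oo] for non-edges. *)
Definition bond s t : F := let a := [set s; t]%SET in
  if a \in edges Gamma then eta a + (eta a)^-1 else 2.

Lemma bondC s t : bond s t = bond t s.
Proof. by rewrite /bond finset.setUC. Qed.

Lemma edge_neq s t : [set s; t]%SET \in edges Gamma -> s != t.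
Proof. by move=> /edges_card2; rewrite cards2; case: eqVneq. Qed.

Section Edge.
Context (s t : S).
Hypothesis st : [set s; t]%SET \in edges Gamma.
Let m := label [set s; t]%SET.
Let st_neq : s != t := edge_neq st.

(** The root crossed by letter number [n], counted from 0, of the word [s t s t ...]. *)
Let tau n : V := cheb (bond s t) n.+1 *: e s + cheb (bond s t) n *: e t.

Let tau_antiperiodic n : tau (n + m) = - tau n.
Proof.
rewrite /tau /bond st -addSn !(cheb_antiperiodic (label_ge2 st) (eta_prim st)).
by rewrite !scaleNr opprD.
Qed.

Let tau_sum a : \sum_(k < m) tau (k.*2 + a) = 0.
Proof.
rewrite big_split -!scaler_suml.
under eq_bigr do rewrite -addnS.
rewrite /bond st !(cheb_sum (label_ge2 st) (eta_prim st)).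
by rewrite !scale0r; exact: addr0.
Qed.

Let act_even k : act bond (alt t s k.*2) (e s) = tau k.*2.
Proof. by rewrite (act_alt bondC)// odd_double. Qed.

Let act_odd k : act bond (rcons (alt t s k.*2) s) (e t) = tau k.*2.+1.
Proof.
by rewrite -altS_rcons (act_alt bondC) 1?eq_sym// oddS odd_double bondC.
Qed.

Let alt_doubleS k : alt t s k.+1.*2 = rcons (rcons (alt t s k.*2) s) t.
Proof. by rewrite doubleS !altS_rcons. Qed.

(** The letters cross [tau 0], ..., [tau (2m - 1)], and [tau n] cancels against [tau (n + m)]. *)
Lemma crossing_edge : crossing bond (flatten (nseq m [:: s; t])) =1 (fun=> 0).
Proof.
move=> x; rewrite -alt_double.
have -> k : crossing bond (alt t s k.*2) x =
    \sum_(0 <= n < k.*2) delta (tau n) x.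
  elim: k => [|k IH]; first by rewrite big_nil.
  rewrite alt_doubleS !crossing_rcons.
  by rewrite IH act_even act_odd doubleS !big_nat_recr.
rewrite -addnn big_mkord big_split_ord /= -big_split big1// => i _ /=.
by rewrite addnC tau_antiperiodic deltaNl subrr.
Qed.

(** Every further factor [st] subtracts the next two roots with the fixed coefficients [coroot s x]
    and [coroot t x]; over [m] factors the even and the odd roots each sum to 0. *)
Lemma act_edge : act bond (flatten (nseq m [:: s; t])) =1 id.
Proof.
move=> x; rewrite -alt_double.
have -> k : act bond (alt t s k.*2) x =
    x - (coroot bond s x *: (\sum_(n < k) tau (n.*2 + 0)) +
         coroot bond t x *: (\sum_(n < k) tau (n.*2 + 1))).
  elim: k => [|k IH]; first by rewrite !big_ord0 !scaler0 addr0 subr0.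
  rewrite alt_doubleS !big_ord_recr /=.
  have act_sub w r y z : act bond w (y - r *: z) = act bond w y - r *: act bond w z.
    by rewrite addrC -scaleNr act_linear scaleNr addrC.
  rewrite act_rcons {1}/refl act_sub act_odd act_rcons {1}/refl act_sub act_even IH.
  by rewrite addn0 addn1 !scalerDr addrACA !opprD !addrA.
by rewrite !tau_sum !scaler0 addr0 subr0.
Qed.

End Edge.

Lemma relator_trivial (r : word S) : coxeter_relator r ->
  act bond (unzip1 r) =1 id /\ crossing bond (unzip1 r) =1 (fun=> 0).
Proof.
case=> [s|s t st].
  split=> x /=; first exact: reflK.
  have := crossing_rcons bond [:: s] s x; rewrite /= => ->.
  by rewrite addr0 refl_simple deltaNl subrr.
rewrite /unzip1 /word_power map_flatten map_nseq /=.
by split; [exact: act_edge|exact: crossing_edge].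
Qed.

End Representation.

Section Matsumoto.
Context (Gamma : coxeter_graph) (F : finFieldType) (eta : {set vertex Gamma} -> F).
Local Notation S := (vertex Gamma).
Implicit Types (s t : S) (u v w : seq S).
Local Notation e := (@simple_root S F).
Local Notation act := (act (bond eta)).
Local Notation reduced := (reduced (bond eta)).
Local Notation height := (height (bond eta)).
Local Notation bondC := (bondC eta).

Hypothesis two_neq0 : (2 : F) != 0.
Hypothesis eta_prim : forall a, a \in edges Gamma ->
  (2 * label a).-primitive_root (eta a).
Hypothesis crossing_ker : forall w, act w =1 id ->
  crossing (bond eta) w =1 (fun=> 0).

(** Equality would force [cheb] to be 0 at [j.+1] and 1 at [j]. On an edge the zero contradicts
    [j.+1 < m]; otherwise [cheb 2 n = n], and the two values give [2 = 0] in [F]. *)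
Lemma act_alt_neq s t j : s != t ->
  ([set s; t]%SET \in edges Gamma -> (j.+1 < label [set s; t]%SET)%N) ->
  act (alt t s j) (e s) != e (if odd j then s else t).
Proof.
move=> st jm; rewrite (act_alt bondC)//.
have pq : (if odd j then t else s) != (if odd j then s else t).
  by case: (odd j) => //; rewrite eq_sym.
move: pq; set p := (X in X != _); set q := (X in _ != X) => pq.
apply/eqP => /ffunP eq_e.
have c0 : cheb (bond eta s t) j.+1 = 0.
  have := eq_e p; rewrite !ffunE eqxx (negPf pq) /GRing.scale /=.
  by rewrite mulr1 mulr0 addr0.
have c1 : cheb (bond eta s t) j = 1.
  have := eq_e q; rewrite !ffunE eqxx eq_sym (negPf pq) /GRing.scale /=.
  by rewrite mulr1 mulr0 add0r.
move: c0 c1; rewrite /bond; case: ifPn => [stE c0 _|_].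
  have /dvdn_leq := cheb_eq0 (label_ge2 stE) (eta_prim stE) c0.
  by have := jm stE; lia.
rewrite !cheb2 -natr1 => j1 j0; move: j1; rewrite j0 => /eqP.
by rewrite (negPf two_neq0).
Qed.

(** The alternating tail grows by one letter at a time: [exchange] moves a letter of [x] to the end
    as [s]. *)
Lemma descents_alt q s t k : s != t -> reduced q ->
  height (act q (e s)) < 0 -> height (act q (e t)) < 0 ->
  ([set s; t]%SET \in edges Gamma -> (k <= label [set s; t]%SET)%N) ->
  exists x, [/\ reduced (x ++ alt s t k), act (x ++ alt s t k) =1 act q
    & size (x ++ alt s t k) = size q].
Proof.
move=> + qr; elim: k s t => [|k IH] s t st qs qt km.
  by exists q; rewrite cats0.
have [||||x [xr xq xs]] := IH t s => //; first by rewrite eq_sym.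
  by rewrite finset.setUC => /km/ltnW.
have : height (act (x ++ alt t s k) (e s)) < 0 by rewrite xq.
move=> /(exchange bondC two_neq0 crossing_ker)[w1 [a [w2 [wE w2s w12]]]].
have [[x' xE w2E]|[y yE]] := cat_eq_cat_cons wE; last first.
  (* A deletion inside the alternating tail is excluded by [act_alt_neq]. *)
  have [w2k w2E aE] := alt_split yE.
  have := @act_alt_neq s t (size w2) st; rewrite -w2E w2s aE eqxx.
  by case/(_ _)/negP => // /km; exact: leq_ltn_trans.
have sz : size ((w1 ++ x') ++ alt s t k.+1) = size q.
  by rewrite -xs xE !size_cat !size_alt /=; lia.
have aq : act ((w1 ++ x') ++ alt s t k.+1) =1 act q.
  move=> v; rewrite altS_rcons -cats1 !catA -(catA w1) -w2E act_cat -w12.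
  by rewrite act_rcons reflK xq.
exists (w1 ++ x'); split=> //.
by apply: (reduced_act_eq qr) => //; rewrite sz.
Qed.

Lemma reduced_size_eq u v : reduced u -> reduced v -> act u =1 act v ->
  size u = size v.
Proof.
move=> ur vr uv; apply/eqP; rewrite eqn_leq.
by apply/andP; split; [apply: ur|apply: vr] => x; rewrite uv.
Qed.

Lemma reduced_descent u s : reduced (rcons u s) ->
  height (act (rcons u s) (e s)) < 0.
Proof.
move=> /(reduced_rcons_gt0 bondC two_neq0 crossing_ker).
by rewrite act_rcons refl_simple actN heightN oppr_lt0.
Qed.

(** Matsumoto's theorem, by induction on length. Equal last letters are stripped; distinct ones are
    both descents, and the two words are joined through words ending in the two sides of a braid
    relation. *)
Lemma reduced_word_class u v : reduced u -> reduced v -> act u =1 act v ->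
  word_class u = word_class v.
Proof.
have [n un] := ubnP (size u); elim: n u v un => // n IH u v un ur vr uv.
have uv_size := reduced_size_eq ur vr uv.
have same_last q s p : reduced (rcons q s) -> reduced (rcons p s) ->
    (size q < n)%N -> act (rcons q s) =1 act (rcons p s) ->
    word_class (rcons q s) = word_class (rcons p s).
  move=> qr pr qn qp; rewrite -!cats1 !word_class_cat; congr (_ * _)%g.
  apply: IH => //; first by move: qr; rewrite -cats1 => /reduced_catl.
    by move: pr; rewrite -cats1 => /reduced_catl.
  by move=> x; have := qp (refl (bond eta) s x); rewrite !act_rcons reflK.
case: (lastP u) (lastP v) un ur vr uv uv_size => [|u' s] [|v' t] //;
  rewrite ?size_rcons// ltnS => un ur vr uv uv_size.
have [st|st] := eqVneq s t; first by subst t; exact: same_last.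
have us := reduced_descent ur.
have ut : height (act (rcons u' s) (e t)) < 0.
  by rewrite uv; exact: reduced_descent.
have [stE|stE] := boolP ([set s; t]%SET \in edges Gamma); last first.
  (* Without an edge the tail can have any length; this one exceeds the length of the whole word by
     one. *)
  have [|x [_ _]] := descents_alt (k := (size u').+2) st ur us ut.
    by rewrite (negPf stE).
  by rewrite size_cat size_alt size_rcons; lia.
have tsE : [set t; s]%SET = [set s; t]%SET by rewrite finset.setUC.
pose m := (label [set s; t]%SET).-1.
have mE : label [set s; t]%SET = m.+1 by have := label_ge2 stE; rewrite /m; lia.
have [|x [xr xu xs]] := descents_alt (k := m.+1) st ur us ut; first by rewrite mE.
have x_braid : act (x ++ alt t s m.+1) =1 act (x ++ alt s t m.+1).
  move=> z; rewrite !act_cat -[in RHS](act_edge eta_prim stE z) mE -rev_alt_cat.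
  by rewrite [in RHS]act_cat act_revK.
have xr' : reduced (x ++ alt t s m.+1).
  apply: (reduced_act_eq ur) => [z|]; first by rewrite x_braid xu.
  by rewrite -xs !size_cat !size_alt.
(* [alt s t] ends in [s] like [u], and [alt t s] ends in [t] like [v], so [same_last] applies on
   either side of the braid relation. *)
transitivity (word_class (x ++ alt s t m.+1)).
  move: xr xu; rewrite altS_rcons -rcons_cat => xr xu.
  by apply: same_last => // z; rewrite xu.
rewrite word_class_cat -mE word_class_braid// mE -word_class_cat.
move: xr' (x_braid) xs; rewrite altS_rcons -rcons_cat => xr' xb xs.
apply: same_last => //; last by move=> z; rewrite xb xu uv.
by move: xs; rewrite !size_cat !size_alt/= size_rcons; lia.
Qed.

(** Every word has the class of a reduced word with the same action, and a reduced word acting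
    trivially is empty. *)
Lemma act_word_class w : act w =1 id -> word_class w = 1%g.
Proof.
have [u [ur uw wu]] :
    exists u, [/\ reduced u, act u =1 act w & word_class w = word_class u].
  elim/last_ind: w => [|w s [u [ur uw wu]]]; first by exists [::]; split=> // u.
  have ws : act (rcons u s) =1 act (rcons w s) by move=> z; rewrite !act_rcons uw.
  have wcs : word_class (rcons w s) = word_class (rcons u s).
    by rewrite -!cats1 !word_class_cat wu.
  have [us|us] := ltP (height (act u (e s))) 0; last first.
    exists (rcons u s); split=> //; apply: gt0_reduced_rcons => //.
    - exact: bondC.
    - by rewrite lt_neqAle us eq_sym height_root_neq0//; exact: bondC.
  (* When [s] is a descent, [u] has the class of the reduced word [w1 w2 s], and the appended [s]
     cancels. *)
  have [w1 [a [w2 [uE _ w12]]]] := exchange bondC two_neq0 crossing_ker us.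
  have r12 : act (rcons (w1 ++ w2) s) =1 act u.
    by move=> z; rewrite act_rcons -w12 act_rcons reflK.
  have rr : reduced (rcons (w1 ++ w2) s).
    apply: (reduced_act_eq ur r12).
    by rewrite uE size_rcons !size_cat /=; lia.
  exists (w1 ++ w2); split.
  - by move: rr; rewrite -cats1 => /reduced_catl.
  - by move=> z; rewrite -w12 ws.
  rewrite wcs -cats1 word_class_cat -(reduced_word_class rr ur r12).
  by rewrite -cats1 word_class_cat -mulgA word_class_sq mulg1.
move=> w1; have : (size u <= 0)%N by apply: (ur [::]) => z; rewrite uw w1.
by rewrite leqn0 size_eq0 => /eqP u0; rewrite wu u0.
Qed.

End Matsumoto.

Local Open Scope classical_set_scope.

(** * Euclidean spaces and induced affine actions *)

(* A copy of the row vectors, which the library equips with the sup norm. *)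
Definition euclidean (R : realType) (n : nat) := 'rV[R]_n.
HB.instance Definition _ R n := GRing.Lmodule.on (euclidean R n).

Section Euclidean.
Context (R : realType) (n : nat).
Implicit Types x y z : euclidean R n.

Definition edot x y : R := \sum_i x ord0 i * y ord0 i.

Lemma edotC x y : edot x y = edot y x.
Proof. by apply: eq_bigr => i _; rewrite mulrC. Qed.

Lemma edot_bilinear :
  bilinear_for (@GRing.mul R) (@GRing.mul R) edot.
Proof.
have edotl z : linear_for (@GRing.mul R) (edot^~ z).
  move=> a x y; rewrite /edot mulr_sumr -big_split; apply: eq_bigr => i _.
  by rewrite !mxE mulrDl mulrA.
by split=> // z a x y; rewrite ![edot z _]edotC edotl.
Qed.

HB.instance Definition _ :=
  bilinear_isBilinear.Build R (euclidean R n) (euclidean R n) R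
    (@GRing.mul R) (@GRing.mul R) edot edot_bilinear.

Lemma edot_ge0 x : 0 <= edot x x.
Proof. by apply: sumr_ge0 => i _; rewrite -expr2 sqr_ge0. Qed.

Lemma edot_eq0 x : edot x x = 0 -> x = 0.
Proof.
move=> x0; apply/rowP => i; rewrite mxE; apply/eqP; rewrite -sqrf_eq0 expr2.
have sq_ge0 j : true -> 0 <= x ord0 j * x ord0 j by rewrite -expr2 sqr_ge0.
by rewrite (psumr_eq0P sq_ge0 x0).
Qed.

Lemma edot_neq0_gt0 x : x != 0 -> 0 < edot x x.
Proof.
move=> x0; rewrite lt_neqAle edot_ge0 andbT eq_sym.
by apply: contra x0 => /eqP/edot_eq0 ->.
Qed.

HB.instance Definition _ := isHermitianSesquilinear.Build R (euclidean R n)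
  false idfun edot (fun x y => etrans (edotC x y) (esym (mul1r _))).
HB.instance Definition _ :=
  isDotProduct.Build R (euclidean R n) edot edot_neq0_gt0.

Definition enorm x : R := Num.sqrt (edot x x).

Lemma cauchy_schwarz x y : edot x y <= enorm x * enorm y.
Proof.
have [/edot_eq0 ->|y0] := eqVneq (edot y y) 0.
  by rewrite linear0r mulr_ge0 ?sqrtr_ge0.
have q0 : 0 < edot y y by rewrite lt_neqAle eq_sym y0 edot_ge0.
rewrite -sqrtrM ?edot_ge0// (le_trans (ler_norm _))// -sqrtr_sqr ler_wsqrtr//.
(* Expand the square norm of [q x - r y], where [q = y.y] and [r = x.y]. *)
have := edot_ge0 (edot y y *: x - edot x y *: y).
rewrite linearBl !linearBr !linearZl_LR !linearZr_LR /= (edotC y x).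
set p := edot x x; set r := edot x y; set q := edot y y in q0 *.
rewrite (_ : _ - _ = q * (p * q - r ^+ 2)); last by ring.
by rewrite pmulr_rge0// subr_ge0.
Qed.

Lemma ler_enormD x y : enorm (x + y) <= enorm x + enorm y.
Proof.
rewrite -(@ler_pXn2r _ 2)// ?nnegrE ?addr_ge0 ?sqrtr_ge0//.
rewrite sqrrD !sqr_sqrtr ?edot_ge0// linearDl !linearDr/= (edotC y x).
by have := cauchy_schwarz x y; rewrite /enorm; lra.
Qed.

Lemma enormZ a x : enorm (a *: x) = `|a| * enorm x.
Proof.
by rewrite /enorm linearZl_LR linearZr_LR/= mulrA -expr2 sqrtrM ?sqr_ge0// sqrtr_sqr.
Qed.

Lemma enorm_eq0 x : enorm x = 0 -> x = 0.
Proof.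
move=> /eqP; rewrite sqrtr_eq0 => x0; apply: edot_eq0.
by apply/eqP; rewrite eq_le x0 edot_ge0.
Qed.

HB.instance Definition _ :=
  Lmodule_isNormed.Build R (euclidean R n) ler_enormD enormZ enorm_eq0.

Lemma le_coord_enorm x i : `|x ord0 i| <= enorm x.
Proof.
rewrite -sqrtr_sqr ler_wsqrtr// expr2 /edot (bigD1 i)//= lerDl.
by apply: sumr_ge0 => j _; rewrite -expr2 sqr_ge0.
Qed.

Lemma enorm_le_sum x : enorm x <= \sum_i `|x ord0 i|.
Proof.
have s0 : 0 <= \sum_i `|x ord0 i| by exact: sumr_ge0.
rewrite -[leRHS]ger0_norm// -sqrtr_sqr ler_wsqrtr// expr2 mulr_suml ler_sum// => i _.
rewrite -expr2 -real_normK ?num_real// expr2.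
rewrite ler_wpM2l// (bigD1 i)//= lerDl.
exact: sumr_ge0.
Qed.

Lemma euclidean_complete (F : set_system (euclidean R n)) :
  ProperFilter F -> cauchy F -> cvg F.
Proof.
move=> FF /cauchyP Fc.
have coordF i : cvg ((fun x : euclidean R n => x ord0 i) @ F).
  apply: cauchy_cvg; apply/cauchyP => e e0.
  have [x Fx] := Fc e e0; exists (x ord0 i).
  change (F ((fun y : euclidean R n => y ord0 i) @^-1` ball (x ord0 i) e)).
  apply: filterS Fx => y; rewrite /= -!ball_normE /=.
  apply: le_lt_trans; have := le_coord_enorm (x - y) i.
  by rewrite !mxE.
pose l : euclidean R n := \row_i lim ((fun x : euclidean R n => x ord0 i) @ F).
apply/cvg_ex; exists l; apply/cvgrPdist_lt => e e0.
(* Dividing by [n + 1] covers [n = 0] and keeps the sum of the [n] bounds strictly below [e]. *)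
have e'0 : 0 < e / n.+1%:R by rewrite divr_gt0.
have : F [set x : euclidean R n | forall i, `|l ord0 i - x ord0 i| < e / n.+1%:R].
  apply: filter_forall => i; rewrite mxE.
  have := coordF i; move=> /cvgrPdist_lt/(_ _ e'0).
  exact.
apply: filterS => x xl.
apply: (le_lt_trans (enorm_le_sum (l - x))).
apply: (@le_lt_trans _ _ (\sum_(i < n) e / n.+1%:R)).
  by apply: ler_sum => i _; have := ltW (xl i); rewrite !mxE.
rewrite sumr_const card_ord -[_ *+ n]mulr_natr mulrAC ltr_pdivrMr ?ltr0n//.
by rewrite ltr_pM2l// ltr_nat.
Qed.

HB.instance Definition _ :=
  Uniform_isComplete.Build (euclidean R n) euclidean_complete.

Lemma edot_norm x : edot x x = `|x| ^+ 2.
Proof. by rewrite sqr_sqrtr ?edot_ge0. Qed.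

End Euclidean.

(** * Cosets of finite index subgroups *)

Section FiniteIndex.
Context (G : groupType) (H : {pred G}).
Local Open Scope group_scope.

Lemma finite_index_transversal : finite_index_subgroup H ->
  exists n (idx : G -> 'I_n) (r : 'I_n -> G),
    [/\ cancel r idx, forall g, (r (idx g))^-1 * g \in H
      & forall g h, h \in H -> idx (g * h) = idx g].
Proof.
case=> Hgrp; pose coset g := [set g * h | h in [set` H]].
rewrite -/(range coset) => /finite_seqP[s sE].
have Hc g h : h \in H -> coset (g * h) = coset g.
  move=> hH; apply/seteqP; split=> x [k /= kH <-].
    by exists (h * k); rewrite ?mulgA//=; exact: group_closedM.
  exists (h^-1 * k); first exact/group_closedM/kH/group_closedV.
  by rewrite -mulgA mulVKg.
have cH g g' : coset g = coset g' -> g^-1 * g' \in H.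
  move=> gg'; have : coset g' g' by exists 1; [exact: Hgrp.1|rewrite mulg1].
  by rewrite -gg' => -[h hH <-]; rewrite mulKg.
have cs g : coset g \in undup s.
  by rewrite mem_undup; have : range coset (coset g) by []; rewrite sE.
have rP (i : 'I_(size (undup s))) : {g | coset g = nth set0 (undup s) i}.
  have : [set` s] (nth set0 (undup s) i) by rewrite /= -mem_undup mem_nth.
  by rewrite -sE => iR; apply: cid; case: iR => g _; exists g.
have ilt g : (index (coset g) (undup s) < size (undup s))%N by rewrite index_mem.
pose idx g := Ordinal (ilt g).
exists (size (undup s)), idx, (fun i => sval (rP i)); split.
- move=> i; apply: val_inj => /=; rewrite (svalP (rP i)).
  by rewrite index_uniq ?undup_uniq.
- by move=> g; apply: cH; rewrite (svalP (rP _)) nth_index.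
- by move=> g h hH; apply: val_inj; rewrite /= Hc.
Qed.

(** The value of [f] determines the coset, so the cosets are among the values of a function on
    [T]. *)
Lemma finite_index_fibers (T : finType) (f : G -> T) : group_closed H ->
  (forall g g', f g = f g' -> g^-1 * g' \in H) -> finite_index_subgroup H.
Proof.
move=> Hgrp fH; split=> //; set coset := fun g : G => _.
have Hc g g' : f g = f g' -> coset g `<=` coset g'.
  move=> /esym/fH hH x [k /= kH <-]; exists (g'^-1 * g * k).
    exact: group_closedM.
  by rewrite !mulgA mulgV mul1g.
pose c t : set G :=
  if pselect (exists g, f g = t) is left e then coset (sval (cid e)) else set0.
apply: (@sub_finite_set _ _ (c @` [set: T])).
  move=> _ [g _ <-]; exists (f g) => //; rewrite /c.
  case: pselect => [e|[]]; last by exists g.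
  by case: cid => g' /= gg'; apply/seteqP; split; apply: Hc.
exact/finite_image/finite_finset.
Qed.

End FiniteIndex.

Section InducedAction.
Context (R : realType) (G : groupType) (H : {pred G}) (phi : G -> int).
Hypotheses (Hgrp : group_closed H)
  (phiM : {in H &, {morph phi : x y / (x * y)%g >-> x + y}}).
Context (n : nat) (idx : G -> 'I_n) (r : 'I_n -> G).
Hypotheses (rK : cancel r idx) (idxP : forall g, ((r (idx g))^-1 * g)%g \in H)
  (idxM : forall g h, h \in H -> idx (g * h)%g = idx g).

(** A right action on coset indices, so that permuting coordinates by it is a left action. *)
Let perm (g : G) (i : 'I_n) : 'I_n := idx (g^-1 * r i)%g.

Let permM g h i : perm (g * h)%g i = perm h (perm g i).
Proof.
rewrite /perm -(idxM (h^-1 * r (idx (g^-1 * r i)))%g (idxP (g^-1 * r i)%g)).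
by rewrite invgM !mulgA mulgK.
Qed.

(** The element of [H] by which [g * r (perm g i)] differs from the representative [r i]. *)
Let cocycle g i : G := ((r i)^-1 * g * r (perm g i))%g.

Let cocycleH g i : cocycle g i \in H.
Proof.
rewrite /cocycle -[X in X \in H]invgK; apply: group_closedV => //.
by rewrite !invgM invgK !mulgA -mulgA idxP.
Qed.

Let cocycleM g h i : cocycle (g * h)%g i = (cocycle g i * cocycle h (perm g i))%g.
Proof. by rewrite /cocycle permM !mulgA mulgK. Qed.

(** The action of [H] on the line by translations through [phi], induced to [G]. *)
Definition induced_action (g : G) (x : euclidean R n) : euclidean R n :=
  \row_i (x ord0 (perm g i) + (phi (cocycle g i))%:~R).

Lemma induced_actionP : affine_isometric_action induced_action.
Proof.
have phi1 : phi 1%g = 0.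
  have H1 := Hgrp.1; have := phiM H1 H1; rewrite mulg1 => /eqP.
  by rewrite -subr_eq0 opprD addrA subrr add0r oppr_eq0 => /eqP.
have perm1 i : perm 1%g i = i by rewrite /perm invg1 mul1g rK.
have permVK g : cancel (perm g) (perm g^-1).
  by move=> i; rewrite -permM mulgV perm1.
split=> [x|g h x|g x y|g t x y].
- by apply/rowP => i; rewrite mxE /cocycle perm1 mulg1 mulVg phi1 addr0.
- apply/rowP => i; rewrite !mxE permM cocycleM phiM// intrD -addrA.
  by congr (_ + _); exact: addrC.
- congr Num.sqrt; rewrite /edot [RHS](reindex (perm g)) /=; last first.
    exists (perm g^-1) => i _; first exact: permVK.
    by rewrite -{1}[g]invgK permVK.
  by apply: eq_bigr => i _; rewrite !mxE !opprD addrACA subrr addr0.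
- by apply/rowP => i; rewrite !mxE; ring.
Qed.

Lemma induced_action_no_fixpoint h x :
  h \in H -> phi h != 0 -> exists g, induced_action g x != x.
Proof.
(* [k] represents the coset [H]; conjugating by it makes the cocycle at that index exactly [h], so
   this coordinate is translated by [phi h]. *)
move=> hH h0; pose k := r (idx 1%g); exists (k * h * k^-1)%g.
have kH : k \in H.
  by have := group_closedV Hgrp (idxP 1%g); rewrite mulg1 invgK.
apply: contra h0 => /eqP /rowP /(_ (idx 1%g)); rewrite mxE /cocycle /perm.
rewrite -/k !invgM invgK -!mulgA mulVg mulg1.
rewrite idxM ?rK; last by apply: group_closedV.
rewrite mulKg mulVg mulg1 => /eqP.
by rewrite -subr_eq0 addrAC subrr add0r intr_eq0.
Qed.
End InducedAction.

Lemma virtually_indicable_not_property_T (R : realType) (G : groupType) :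
  virtually_indicable G -> ~ property_T R G.
Proof.
move=> [H [fiH [phi [phiM phi_surj]]]].
have [n [idx [r [rK idxP idxM]]]] := finite_index_transversal fiH.
have Hgrp := fiH.1.
move=> /(_ (euclidean R n) (@edot R n) (@edot_norm R n) _
  (induced_actionP R Hgrp phiM rK idxP idxM))[x xfix].
have [h hH h1] := phi_surj 1 I.
have [|g] := induced_action_no_fixpoint Hgrp rK idxP idxM x hH (phi := phi).
  by rewrite h1.
by rewrite xfix eqxx.
Qed.

(** * Virtual indicability *)

(** The image consists of the multiples of its least positive element [d]; dividing by [d] makes it
    all of Z. *)
Lemma nonzero_hom_surjects_Z (G : groupType) (H : {pred G}) (phi : G -> int) :
  group_closed H -> {in H &, {morph phi : x y / (x * y)%g >-> x + y}} ->
  (exists2 h, h \in H & phi h != 0) -> subgroup_surjects_Z H.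
Proof.
move=> Hgrp phiM [h0 h0H phi_h0]; pose A z := exists2 h, h \in H & phi h = z.
have phi1 : phi 1%g = 0.
  have H1 := Hgrp.1; have := phiM _ _ H1 H1; rewrite mulg1 => /eqP.
  by rewrite -subr_eq0 opprD addrA subrr add0r oppr_eq0 => /eqP.
have AD x y : A x -> A y -> A (x + y).
  move=> [h hH <-] [k kH <-]; exists (h * k)%g; last exact: phiM.
  exact: group_closedM.
have AN x : A x -> A (- x).
  move=> [h hH <-]; have hVH := group_closedV Hgrp hH; exists h^-1%g => //.
  by apply/eqP; rewrite -addr_eq0 -phiM// mulVg phi1.
have A0 : A 0 by exists 1%g => //; exact: Hgrp.1.
have [d d0 [Ad dmin]] : exists2 d : nat, (0 < d)%N & A d%:Z /\
    forall n : nat, (0 < n)%N -> A n%:Z -> (d <= n)%N.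
  pose P n := (0 < n)%N && `[< A n%:Z >].
  have exP : exists n, P n.
    exists `|phi h0|%N; rewrite /P absz_gt0 phi_h0; apply/asboolP.
    have A1 : A (phi h0) by exists h0.
    by rewrite abszE; case: (ger0P (phi h0)) => // _; exact: AN.
  case: (ex_minnP exP) => d /andP[d0 /asboolP Ad] dmin.
  by exists d => //; split=> // n n0 An; apply: dmin; rewrite /P n0; apply/asboolP.
have AM z : A (z * d%:Z).
  have AMn (n : nat) : A (n%:Z * d%:Z).
    elim: n => [|n IH]; first by rewrite mul0r.
    by rewrite intS mulrDl mul1r; exact: AD.
  case: (intP z) => [|n|n]; rewrite ?mulNr.
  - by rewrite mul0r.
  - exact: AMn.
  - exact/AN/AMn.
have dvdA z : A z -> (d %| z)%Z.
  move=> Az; apply/dvdz_mod0P; apply/eqP; apply: contraT => mod0.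
  have dz0 : d%:Z != 0 by lia.
  have := modz_ge0 z dz0; have := ltz_mod z dz0.
  have : A (z %% d)%Z by exact: AD Az (AN _ (AM _)).
  case: (z %% d)%Z mod0 => // n n0 An nd _.
  have n_gt0 : (0 < n)%N by rewrite lt0n; move: n0; rewrite eqz_nat.
  by have := dmin n n_gt0 An; lia.
exists (fun g => (phi g %/ d)%Z); split.
  by move=> x y xH yH; rewrite phiM// divzDl//; apply: dvdA; exists x.
move=> z _; have [h hH hz] := AM z; exists h => //.
by rewrite hz mulzK//; lia.
Qed.

Lemma virtually_indicable_pullback (G K : groupType) (H : {pred G}) :
  finite_index_subgroup H -> subgroup_surjects K H -> virtually_indicable K ->
  virtually_indicable G.
Proof.
move=> fiH [f [fM f_surj]] [L [fiL [phi [phiM phi_surj]]]].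
have [Hgrp Lgrp] := (fiH.1, fiL.1).
have f1 : f 1%g = 1%g.
  by apply: (mulIg (f 1%g)); rewrite -fM ?mulg1 ?mul1g//; exact: Hgrp.1.
have fV h : h \in H -> f h^-1%g = (f h)^-1%g.
  move=> hH; apply: (mulIg (f h)); rewrite mulVg -fM ?mulVg//.
  exact: group_closedV.
pose H' : {pred G} := [pred h | (h \in H) && (f h \in L)].
have H'grp : group_closed H'.
  split; first by rewrite inE Hgrp.1 f1 Lgrp.1.
  move=> x y /andP[xH xL] /andP[yH yL]; apply/andP; split; first exact: Hgrp.2.
  by rewrite fM ?fV//; [exact: Lgrp.2|exact: group_closedV].
have [n [idx [r [rK idxP idxM]]]] := finite_index_transversal fiH.
have [n' [idx' [r' [rK' idxP' idxM']]]] := finite_index_transversal fiL.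
exists H'; split.
  (* The coset of [g] modulo [H'] is determined by its coset modulo [H] and the coset modulo [L] of
     the image of its [H]-part. *)
  apply: (@finite_index_fibers _ _ _
    (fun g => (idx g, idx' (f ((r (idx g))^-1 * g)%g)))) => // g g' [gg'].
  set h := ((r (idx g))^-1 * g)%g; set h' := ((r _)^-1 * g')%g => hh'.
  have hH : h \in H by exact: idxP.
  have h'H : h' \in H by exact: idxP.
  have -> : (g^-1 * g' = h^-1 * h')%g.
    by rewrite /h /h' gg' invgM invgK -mulgA mulVKg.
  have hVH := group_closedV Hgrp hH.
  apply/andP; split; first exact: group_closedM.
  have := group_closedM Lgrp (group_closedV Lgrp (idxP' (f h))) (idxP' (f h')).
  by rewrite hh' invgM invgK -mulgA mulVKg (fM _ _ hVH h'H) (fV _ hH).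
exists (phi \o f); split.
  by move=> x y /andP[xH xL] /andP[yH yL] /=; rewrite fM// phiM.
move=> z _; have [l lL lz] := phi_surj z I; have [h hH hl] := f_surj l I.
by exists h; rewrite /= ?hl//; apply/andP; rewrite hl.
Qed.

(** * The congruence kernel of a Coxeter group and its crossing homomorphism *)

Section CoxeterGroup.
Context (Gamma : coxeter_graph) (F : finFieldType) (eta : {set vertex Gamma} -> F).
Local Notation S := (vertex Gamma).
Local Notation V := {ffun S -> F^o}.
Local Notation W := (coxeter_group Gamma).
Hypothesis eta_prim : forall a, a \in edges Gamma ->
  (2 * label a).-primitive_root (eta a).
Local Notation act := (act (bond eta)).
Local Notation crossing := (crossing (bond eta)).
Local Notation letters x := (unzip1 (repr (x : W))).

Lemma pres_rel_act (u v : word S) : pres_rel (@coxeter_relator Gamma) u v ->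
  act (unzip1 u) =1 act (unzip1 v) /\ crossing (unzip1 u) =1 crossing (unzip1 v).
Proof.
have insert (p r q : seq S) : act r =1 id -> crossing r =1 (fun=> 0) ->
    act (p ++ r ++ q) =1 act (p ++ q) /\
    crossing (p ++ r ++ q) =1 crossing (p ++ q).
  move=> r1 r0; split=> x; first by rewrite !act_cat r1.
  by rewrite !crossing_cat r0 add0r -{1}[act (rev p) x]r1 act_rev.
elim=> {u v} [u|u v _ [uv uv']|u v w _ [uv uv'] _ [vw vw']|u v s b|u v r rr].
- by split.
- by split=> x.
- by split=> x; rewrite ?uv ?uv'.
(* With signs forgotten, a cancelling pair is the square relator [s s]. *)
- have [s1 s0] := relator_trivial eta_prim (square_relator s).
  by rewrite /unzip1 !map_cat; exact: (insert _ [:: s; s]).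
- have [r1 r0] := relator_trivial eta_prim rr.
  by rewrite /unzip1 !map_cat; exact: insert.
Qed.

Lemma act_mul (x y : W) v :
  act (letters (x * y)%g) v = act (letters x) (act (letters y) v).
Proof.
have [-> _] := pres_rel_act (pres_reprK _ (repr x ++ repr y)).
by rewrite /unzip1 map_cat act_cat.
Qed.

Lemma act_one v : act (letters 1%g) v = v.
Proof. by have [-> _] := pres_rel_act (pres_reprK (@coxeter_relator Gamma) [::]). Qed.

Lemma act_inv (x : W) v : act (letters x^-1%g) (act (letters x) v) = v.
Proof. by rewrite -act_mul mulVg act_one. Qed.

(** The twist in the cocycle identity disappears when [x] acts trivially. *)
Lemma crossing_mul (x y : W) v : act (letters x) =1 id ->
  crossing (letters (x * y)%g) v = crossing (letters x) v + crossing (letters y) v.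
Proof.
have [_ ->] := pres_rel_act (pres_reprK _ (repr x ++ repr y)) => x1.
rewrite /unzip1 map_cat crossing_cat; congr (_ + crossing _ _).
by rewrite -{1}[v]x1 act_rev.
Qed.

Definition congruence_kernel : {pred W} :=
  [pred x : W | `[< act (letters x) =1 id >]].

Lemma congruence_kernelP x : reflect (act (letters x) =1 id) (x \in congruence_kernel).
Proof. exact: asboolP. Qed.

Let fiber (x : W) : {ffun V -> V} := [ffun v => act (letters x) v].

Let fiber_eq x y : fiber x = fiber y -> (x^-1 * y)%g \in congruence_kernel.
Proof.
move=> /ffunP xy; apply/congruence_kernelP => v.
by have := xy v; rewrite !ffunE act_mul => <-; exact: act_inv.
Qed.

Lemma congruence_kernel_finite_index : finite_index_subgroup congruence_kernel.
Proof.
apply: (finite_index_fibers (f := fiber)); last exact: fiber_eq.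
split; first by apply/congruence_kernelP => v; rewrite act_one.
move=> x y /congruence_kernelP x1 /congruence_kernelP y1.
apply/congruence_kernelP => v; rewrite act_mul x1.
by rewrite -{1}[v]y1 act_inv.
Qed.

(** Otherwise [act_word_class] would make the action faithful and embed W in the finite set of
    self-maps of [V]. *)
Lemma crossing_kernel_neq0 : (2 : F) != 0 -> infinite_set [set: W] ->
  exists2 x, x \in congruence_kernel & exists v, crossing (letters x) v != 0.
Proof.
move=> two_neq0 Winf; apply: contrapT => no.
have crossing_ker w : act w =1 id -> crossing w =1 (fun=> 0).
  move=> w1 v; apply/eqP/negPn/negP => wv; apply: no.
  have [wa wc] :=
    pres_rel_act (pres_reprK (@coxeter_relator Gamma) [seq (s, false) | s <- w]).
  have ww : unzip1 [seq (s, false) | s <- w] = w.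
    by rewrite /unzip1 -map_comp map_id.
  rewrite ww in wa wc.
  exists (word_class w); last by exists v; rewrite wc.
  by apply/congruence_kernelP => z; rewrite wa w1.
apply: Winf; rewrite -(preimage_setT fiber); apply: finite_preimage.
  move=> x y _ _ /fiber_eq/congruence_kernelP.
  move=> /(act_word_class two_neq0 eta_prim crossing_ker).
  by rewrite word_class_repr => /(congr1 (fun z => x * z)%g); rewrite mulVKg mulg1.
exact: finite_finset.
Qed.

End CoxeterGroup.

Theorem infinite_coxeter_virtually_indicable (Gamma : coxeter_graph) :
  infinite_set [set: coxeter_group Gamma] ->
  virtually_indicable (coxeter_group Gamma).
Proof.
(* The product lets a single field serve all edges. *)
move=> Winf; pose N := (\prod_(a in edges Gamma) (2 * label a))%N.
have N0 : (0 < N)%N.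
  by apply: prodn_cond_gt0 => a /label_ge2 a2; rewrite muln_gt0 (ltnW a2).
have [F [two_neq0 rootF]] := finite_field_with_roots N0.
have /choice[eta eta_prim] a : exists z : F,
    a \in edges Gamma -> (2 * label a).-primitive_root z.
  have [aE|aE] := boolP (a \in edges Gamma); last by exists 0.
  have [|z zP] := rootF (2 * label a)%N; last by exists z.
  by rewrite /N (bigD1 a)//= dvdn_mulr.
have [x xK [v xv]] := crossing_kernel_neq0 eta_prim two_neq0 Winf.
have fi := congruence_kernel_finite_index eta_prim.
exists (congruence_kernel eta); split=> //.
(* Evaluation at one [v] where the crossing is nonzero gives an integer-valued homomorphism. *)
apply: (nonzero_hom_surjects_Z (phi := fun x : coxeter_group Gamma =>
  crossing (bond eta) (unzip1 (repr x)) v)).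
- exact: fi.1.
- by move=> y z /congruence_kernelP y1 _ /=; rewrite crossing_mul.
- by exists x.
Qed.

Theorem corollary1p2 (R : realType) (Gamma : coxeter_graph)
    (hW : in_class_W Gamma) :
  virtually_indicable (aut (coxeter_group Gamma)) /\
  ~ property_T R (aut (coxeter_group Gamma)).
Proof.
have vi : virtually_indicable (aut (coxeter_group Gamma)).
  have [H [fiH [Delta [Dinf f]]]] := hW.
  apply: (virtually_indicable_pullback fiH f).
  exact: infinite_coxeter_virtually_indicable.
by split=> //; exact: virtually_indicable_not_property_T.
Qed.
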